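(* Let $(X,\mathcal{A})$ be a measurable space and let $\mu\colon\mathcal{A}\to[0,\infty]$ be a nonadditive measure. Assume that $\mu$ has property (C) and the pseudometric generating property (p.g.p.). Then, for any sequence $\{f_n\}_{n\in\mathbb{N}}\subset\mathcal{F}_0(X)$ the following assertions are equivalent. (i) $\{f_n\}_{n\in\mathbb{N}}$ is Cauchy in $\mu$-measure. (ii) $\{f_n\}_{n\in\mathbb{N}}$ converges in $\mu$-measure.
   Context: $X$ is a nonempty set and $\mathcal{A}$ is a $\sigma$-field of subsets of $X$. A nonadditive measure is a set function $\mu\colon\mathcal{A}\to[0,\infty]$ with $\mu(\emptyset)=0$ and $\mu(A)\le\mu(B)$ whenever $A,B\in\mathcal{A}$, $A\subset B$. $\mathcal{F}_0(X)$ is the set of all $\mathcal{A}$-measurable functions $X\to\mathbb{R}$. Property (C): for any sequence $\{E_n\}_{n\in\mathbb{N}}\subset\mathcal{A}$, if $\sup_{l\in\mathbb{N}}\mu\left(\bigcup_{n=k}^{k+l}E_n\right)\to 0$ as $k\to\infty$, then $\mu\left(\bigcup_{n=k}^\infty E_n\right)\to 0$ as $k\to\infty$. (p.g.p.): $\mu(A_n\cup B_n)\to 0$ whenever $A_n,B_n\in\mathcal{A}$ and $\max\{\mu(A_n),\mu(B_n)\}\to 0$. $\{f_n\}$ is Cauchy in $\mu$-measure if for any $\varepsilon>0$ and $\delta>0$ there is $n_0\in\mathbb{N}$ such that $\mu(\{|f_m-f_n|>\varepsilon\})<\delta$ whenever $m,n\ge n_0$. $\{f_n\}$ converges in $\mu$-measure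 to $f\in\mathcal{F}_0(X)$ if $\mu(\{|f_n-f|>\varepsilon\})\to 0$ for every $\varepsilon>0$; it converges in $\mu$-measure if it does so to some $f\in\mathcal{F}_0(X)$. *)

(* Defs.v *)
From HB Require Import structures.
From mathcomp Require Import all_boot all_order all_algebra.
From mathcomp Require Import all_classical all_reals all_analysis.

Set Implicit Arguments.
Unset Strict Implicit.
Unset Printing Implicit Defensive.

Import Order.TTheory GRing.Theory Num.Theory.
Import numFieldNormedType.Exports.

Local Open Scope classical_set_scope.
Local Open Scope ring_scope.

(* A set function on the sigma-field is represented by a total function on
   [set T]; only its values on measurable sets are ever constrained or used.
   A [measurableType] is pointed, so the underlying space is nonempty. *)
Definition nonadditive_measure (d : measure_display) (T : measurableType d)
    (R : realType) (mu : set T -> \bar R) : Prop :=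
  [/\ mu set0 = 0%E,
      (forall A, measurable A -> (0 <= mu A)%E) &
      (forall A B, measurable A -> measurable B -> A `<=` B ->
         (mu A <= mu B)%E)].

Definition property_C (d : measure_display) (T : measurableType d)
    (R : realType) (mu : set T -> \bar R) : Prop :=
  forall E : nat -> set T, (forall n, measurable (E n)) ->
    ereal_sup (range (fun l : nat =>
       mu (\bigcup_(n in [set n : nat | (k <= n <= k + l)%N]) E n)))
      @[k --> \oo] --> 0%E ->
    mu (\bigcup_(n in [set n : nat | (k <= n)%N]) E n) @[k --> \oo] --> 0%E.

Definition pseudometric_generating (d : measure_display)
    (T : measurableType d) (R : realType) (mu : set T -> \bar R) : Prop :=
  forall A B : nat -> set T,
    (forall n, measurable (A n)) -> (forall n, measurable (B n)) ->
    maxe (mu (A n)) (mu (B n)) @[n --> \oo] --> 0%E ->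
    mu (A n `|` B n) @[n --> \oo] --> 0%E.

Definition cauchy_in_measure (d : measure_display) (T : measurableType d)
    (R : realType) (mu : set T -> \bar R) (f : nat -> {mfun T >-> R}) : Prop :=
  forall eps delta : R, 0 < eps -> 0 < delta ->
    exists n0 : nat, forall m n : nat, (n0 <= m)%N -> (n0 <= n)%N ->
      (mu [set x | (eps < `|f m x - f n x|)%R] < delta%:E)%E.

Definition converges_in_measure_to (d : measure_display)
    (T : measurableType d) (R : realType) (mu : set T -> \bar R)
    (f : nat -> {mfun T >-> R}) (g : {mfun T >-> R}) : Prop :=
  forall eps : R, 0 < eps ->
    mu [set x | (eps < `|f n x - g x|)%R] @[n --> \oo] --> 0%E.

Definition converges_in_measure (d : measure_display) (T : measurableType d)
    (R : realType) (mu : set T -> \bar R) (f : nat -> {mfun T >-> R}) : Prop :=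
  exists g : {mfun T >-> R}, converges_in_measure_to mu f g.

(* Main.v *)
(* By (p.g.p.) there are delta_k > 0 such that the union of any finite block
   E_k, ..., E_(k+l) of sets with mu E_j < delta_j has measure below a quantity
   that tends to 0 as k grows; property (C) passes this to the tails of the
   sequence.  For a Cauchy sequence, pick a subsequence (s k) such that
   E_k = {|f_(s (k+1)) - f_(s k)| > 2^-k} satisfies mu E_k < delta_k.  Off the
   tail F_k, f_(s i) converges at rate 2^(1-i) for i >= k, and
   {|f_n - g| > e} is covered by {|f_n - f_(s k)| > e/2} and F_k, so that
   (p.g.p.) concludes.  The converse is (p.g.p.) and the triangle inequality. *)
Require Import Defs.
From HB Require Import structures.
From mathcomp Require Import all_boot all_order all_algebra.
From mathcomp Require Import all_classical all_reals all_analysis.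
From mathcomp Require Import measurable_realfun zify lra.

Set Implicit Arguments.
Unset Strict Implicit.
Unset Printing Implicit Defensive.

Import Order.TTheory GRing.Theory Num.Theory.
Import numFieldNormedType.Exports.

Local Open Scope classical_set_scope.
Local Open Scope ring_scope.

Lemma cvge0_ltP (R : realType) (u : nat -> \bar R) :
  (forall n, 0 <= u n)%E ->
  u n @[n --> \oo] --> 0%E <->
  (forall e : R, 0 < e -> \forall n \near \oo, (u n < e%:E)%E).
Proof.
move=> u0; split=> [ucvg e e0|ult].
  have /ucvg// : nbhs (0%:E : \bar R) [set y | (y < e%:E)%E].
  exact: (@nbhs_open_ereal_lt R 0 (fun=> e)).
have ufin n e : (u n < e%:E)%E -> u n \is a fin_num.
  by rewrite ge0_fin_numE// => /lt_trans; apply; rewrite ltry.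
(* The values may be infinite, so finiteness is secured first: any positive bound does, here 1. *)
apply/fine_cvgP; split.
  by apply: filterS (ult 1 ltr01) => n; exact: ufin.
apply/cvgr0Pnorm_lt => e e0; apply: filterS (ult e e0) => n une /=.
by rewrite ger0_norm ?fine_ge0// -lte_fin fineK// (ufin _ _ une).
Qed.

Lemma measurable_dist_gt (d : measure_display) (T : measurableType d)
    (R : realType) (f g : {mfun T >-> R}) (e : R) :
  measurable [set x | e < `|f x - g x|].
Proof.
have mfg : measurable_fun setT (fun x => `|f x - g x|).
  by apply: (measurableT_comp (@normr_measurable _ setT)); exact: measurable_funB.
rewrite (_ : mkset _ = setT `&` (fun x => `|f x - g x|) @^-1` `]e, +oo[%classic).
  by apply: mfg.
by rewrite setTI; apply/seteqP; split=> x /=; rewrite in_itv/= andbT.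
Qed.

Lemma dist_gt_subU (T : Type) (R : realType) (f g h : T -> R) (e : R) :
  [set x | e < `|f x - h x|] `<=`
  [set x | e / 2 < `|f x - g x|] `|` [set x | e / 2 < `|g x - h x|].
Proof.
move=> x /= efh; have := ler_distD (g x) (f x) (h x).
by case: (ltP (e / 2) `|f x - g x|) => ? ?; [left|right; lra].
Qed.

Lemma near_half_expr_lt (R : realType) (e : R) :
  0 < e -> \forall k \near \oo, (1 / 2) ^+ k < e.
Proof.
move=> e0; have : (fun k => (1 / 2 : R) ^+ k) @ \oo --> (0 : R).
  by apply: cvg_expr; rewrite ger0_norm; lra.
move=> /cvgr0Pnorm_lt/(_ e e0); apply: filterS => k.
by apply: le_lt_trans; exact: ler_norm.
Qed.

(** The increments are dominated by a geometric series whose tail from [i] sums to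
    [2 * (1 / 2) ^+ i]. *)
Lemma cvg_dyadic_increments (R : realType) (u : nat -> R) (k : nat) :
  (forall i, (k <= i)%N -> `|u i.+1 - u i| <= (1 / 2) ^+ i) ->
  exists2 l : R, u n @[n --> \oo] --> l &
    forall i, (k <= i)%N -> `|u i - l| <= 2 * (1 / 2) ^+ i.
Proof.
move=> du.
(* Keeping the exact partial sum on the right makes the induction close: the step from [j] to [j.+1]
   raises it by exactly [(1 / 2) ^+ (i + j)]. *)
have dist i j : (k <= i)%N ->
    `|u (i + j)%N - u i| <= 2 * (1 / 2) ^+ i - 2 * (1 / 2) ^+ (i + j)%N.
  move=> ki; elim: j => [|j IH]; first by rewrite addn0 !subrr normr0.
  have := du (i + j)%N (leq_trans ki (leq_addr j i)).
  have := ler_distD (u (i + j)%N) (u (i + j).+1) (u i).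
  rewrite addnS exprS; move: ((1/2) ^+ i) ((1 / 2) ^+ (i + j)%N) IH => a b; lra.
have dist2 i n : (k <= i)%N -> (i <= n)%N -> `|u i - u n| <= 2 * (1 / 2) ^+ i.
  move=> ki /subnKC <-; rewrite distrC (le_trans (dist _ _ ki))// gerBl.
  by rewrite mulr_ge0// exprn_ge0// divr_ge0.
have : cvg (u n @[n --> \oo]).
  apply: cauchy_cvg; apply: cauchy_exP => e e0.
  have [i0 _ small] := near_half_expr_lt (divr_gt0 e0 (ltr0Sn R 1)).
  pose i := maxn k i0.
  exists (u i); exists i => // n /= lein.
  rewrite /ball/= (le_lt_trans (dist2 _ _ (leq_maxl _ _) lein))//.
  by have := small i (leq_maxr _ _) => /=; rewrite -/i; lra.
move=> /cvg_ex[l ul]; exists l => // i ki.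
have uil : `|u i - u n| @[n --> \oo] --> `|u i - l|.
  by apply: cvg_norm; apply: cvgB => //; exact: cvg_cst.
rewrite -(cvg_lim (@Rhausdorff R) uil); apply: limr_le.
  by apply/cvg_ex; exists `|u i - l|.
by exists i => // n /= lein; exact: dist2.
Qed.

Lemma mfun_limit (d : measure_display) (T : measurableType d) (R : realType)
    (f : nat -> {mfun T >-> R}) :
  exists g : {mfun T >-> R}, forall x (l : R),
    f n x @[n --> \oo] --> l -> g x = l.
Proof.
(* [fine] sends the infinite values to 0, so [g] is measurable without any
   convergence assumption. *)
pose g x := fine (limn_esup (fun n => (f n x)%:E)).
have mg : measurable_fun setT g.
  apply: (measurableT_comp (fine_measurable measurableT)).
  by apply: measurable_fun_limn_esup => n; exact/measurable_EFinP.
pose G : {mfun T >-> R} := mfun_Sub (mem_set mg).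
exists G => x l fl; rewrite /= /g.
have [_ ->//] : (limn_einf (fun n => (f n x)%:E) = l%:E) *
               (limn_esup (fun n => (f n x)%:E) = l%:E).
by apply: cvg_limn_einf_sup; apply: cvg_EFin => //; exact: nearW.
Qed.

Section nonadditive.
Context (d : measure_display) (T : measurableType d) (R : realType).
Context (mu : set T -> \bar R) (mu_nonadd : nonadditive_measure mu).

(** If no [r] worked, the choices [r = 1 / (n + 1)] would give pairs of sets with measures tending
    to 0 whose unions all have measure at least [e], against (p.g.p.). *)
Lemma pseudometric_generating_delta :
  pseudometric_generating mu -> forall e : R, 0 < e ->
  exists2 r : R, 0 < r & forall A B, measurable A -> measurable B ->
    (mu A < r%:E)%E -> (mu B < r%:E)%E -> (mu (A `|` B) < e%:E)%E.
Proof.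
have [_ mu0 _] := mu_nonadd => pgp e e0; apply: contrapT => /forall2NP nr.
have /choice[AB ABP] (n : nat) : exists AB : set T * set T,
    [/\ measurable AB.1, measurable AB.2, (mu AB.1 < n.+1%:R^-1%:E)%E,
       (mu AB.2 < n.+1%:R^-1%:E)%E & ~ (mu (AB.1 `|` AB.2) < e%:E)%E].
  have [//|] := nr n.+1%:R^-1; rewrite ?invr_gt0 ?ltr0n//.
  move=> nAB; apply: contrapT => noAB; apply: nAB => A B mA mB muA muB.
  by apply: contrapT => muAB; apply: noAB; exists (A, B).
have U0 n : (0 <= mu ((AB n).1 `|` (AB n).2))%E.
  by rewrite mu0//; have [? ? _ _ _] := ABP n; exact: measurableU.
have /(cvge0_ltP U0)/(_ e e0)[n _ /(_ n (leqnn n))] : mu ((AB n).1 `|` (AB n).2) @[n --> \oo] --> 0%E.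
  apply: (pgp (fun n => (AB n).1) (fun n => (AB n).2)).
  - by move=> n; have [] := ABP n.
  - by move=> n; have [] := ABP n.
  apply/cvge0_ltP => [n|r r0]; first by rewrite le_max mu0//; have [] := ABP n.
  near=> n; have [_ _ A1 A2 _] := ABP n.
  have nr' : (n.+1%:R^-1%:E < r%:E)%E.
    by rewrite lte_fin; near: n; exact: near_infty_natSinv_lt (PosNum r0).
  by rewrite gt_max !(lt_trans _ nr').
by have [] := ABP n.
Unshelve. all: by end_near. Qed.

(** A substitute for the Borel-Cantelli lemma: fast decay replaces summability. The thresholds
    [delta] are fixed before the sets, so that a subsequence can later be picked to meet them. *)
Lemma tail_bigcup_cvg0 :
  property_C mu -> pseudometric_generating mu ->
  exists2 delta : nat -> R, (forall k, 0 < delta k) &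
    forall E : nat -> set T, (forall k, measurable (E k)) ->
      (forall k, mu (E k) < (delta k)%:E)%E ->
      mu (\bigcup_(n in [set n | (k <= n)%N]) E n) @[k --> \oo] --> 0%E.
Proof.
have [_ mu0 mu_mono] := mu_nonadd => mu_C mu_pgp.
(* Putting [0 < e] under the existential makes [D] a total function; its value at nonpositive [e] is
   a dummy 0. *)
have /choice[D DP] (e : R) : exists r : R, 0 < e -> 0 < r /\
    forall A B, measurable A -> measurable B ->
    (mu A < r%:E)%E -> (mu B < r%:E)%E -> (mu (A `|` B) < e%:E)%E.
  have [e0|e0] := boolP (0 < e); last by exists 0.
  by have [r r0 rP] := pseudometric_generating_delta mu_pgp e0; exists r.
(* The bound by [D (gamma k')] lets two sets of measure below [gamma k'.+1] have a union of measure
   below [gamma k']; the halving forces [gamma] to 0. *)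
pose gamma := fix gamma k : R :=
  if k is k'.+1 then Num.min (gamma k' / 2) (D (gamma k')) else 1.
have gamma_gt0 k : 0 < gamma k.
  elim: k => [|k IH] //=; rewrite lt_min divr_gt0//=.
  by have [] := DP _ IH.
have gammaS k : gamma k.+1 <= gamma k / 2 by rewrite /= ge_min lexx.
have gamma_half k : gamma k <= (1 / 2) ^+ k.
  elim: k => [|k IH]; first by rewrite expr0.
  by rewrite exprS (le_trans (gammaS k))//; lra.
(* The index is shifted because [E k] must be merged with a block starting at [k.+1], itself only
   known to lie below [gamma k.+1]. *)
exists (fun k => gamma k.+1) => // E mE muE.
have mU (P : set nat) : measurable (\bigcup_(n in P) E n).
  exact: bigcup_measurable.
(* The bound does not depend on [l]. The start [k] stays general in the induction, since splitting
   off the first set [E k] leaves a shorter block starting at [k.+1]. *)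
have finU l : forall k,
    (mu (\bigcup_(n in [set n | (k <= n <= k + l)%N]) E n) < (gamma k)%:E)%E.
  elim: l => [|l IH] k.
    rewrite (_ : [set n | _] = [set k]); last first.
      apply/seteqP; split=> n /=; first by rewrite addn0 -eqn_leq => /eqP.
      by move=> ->; rewrite addn0 leqnn.
    rewrite bigcup_set1 (lt_le_trans (muE k))// lee_fin (le_trans (gammaS k))//.
    by have := gamma_gt0 k; lra.
  rewrite (_ : [set n | _] =
               k |` [set n | (k.+1 <= n <= k.+1 + l)%N]); last first.
    apply/seteqP; split=> n /=; rewrite addSnnS.
      move=> /andP[]; rewrite leq_eqVlt => /orP[/eqP ->|-> ->]; first by left.
      by right.
    move=> [->|/andP[kn ->]]; first by rewrite leqnn leq_addr.
    by rewrite ltnW.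
  rewrite bigcup_setU1.
  have [_ DgP] := DP _ (gamma_gt0 k).
  have gammaD : ((gamma k.+1)%:E <= (D (gamma k))%:E)%E.
    by rewrite lee_fin /= ge_min lexx orbT.
  by apply: DgP => //; apply: lt_le_trans gammaD.
apply: mu_C => //; apply/cvge0_ltP => [k|e e0].
  apply: (le_trans _ (ereal_sup_ubound (ex_intro2 _ _ 0%N I erefl))).
  exact: mu0.
apply: filterS (near_half_expr_lt e0) => k ke.
apply: (@le_lt_trans _ _ (gamma k)%:E).
  by apply: ge_ereal_sup => _ [l _ <-]; exact/ltW/finU.
by rewrite lte_fin (le_lt_trans (gamma_half k)).
Qed.

Lemma converges_in_measure_cauchy (f : nat -> {mfun T >-> R}) :
  pseudometric_generating mu ->
  converges_in_measure mu f -> cauchy_in_measure mu f.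
Proof.
have [_ mu0 mu_mono] := mu_nonadd => mu_pgp [g fg] e delta e0 delta0.
have [r r0 rP] := pseudometric_generating_delta mu_pgp delta0.
have dist0 n : (0 <= mu [set x | (e / 2 < `|f n x - g x|)%R])%E.
  exact/mu0/measurable_dist_gt.
have /fg/(cvge0_ltP dist0)/(_ r r0)[n0 _ small] : 0 < e / 2 by rewrite divr_gt0.
exists n0 => m n n0m n0n.
apply: (le_lt_trans _ (rP _ _ _ _ (small m n0m) (small n n0n))).
- apply: mu_mono; first exact: measurable_dist_gt.
    by apply: measurableU; exact: measurable_dist_gt.
  move=> x /(dist_gt_subU g)[gx|]; first by left.
  by rewrite /= distrC; right.
- exact: measurable_dist_gt.
- exact: measurable_dist_gt.
Qed.

Lemma cauchy_converges_in_measure (f : nat -> {mfun T >-> R}) :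
  property_C mu -> pseudometric_generating mu ->
  cauchy_in_measure mu f -> converges_in_measure mu f.
Proof.
have [_ mu0 mu_mono] := mu_nonadd => mu_C mu_pgp f_cauchy.
have [delta delta0 deltaP] := tail_bigcup_cvg0 mu_C mu_pgp.
have /choice[N NP] (k : nat) : exists N : nat, forall m n, (N <= m)%N ->
    (N <= n)%N ->
    (mu [set x | ((1 / 2) ^+ k < `|f m x - f n x|)%R] < (delta k)%:E)%E.
  by apply: f_cauchy; rewrite ?exprn_gt0// divr_gt0.
(* Both [s k] and [s k.+1] are at least [N k], the latter through the summand [N k.-1], without
   monotonicity of [N]; the summand [k] gives [k <= s k]. *)
pose s k := (k + N k + N k.-1)%N.
pose E k := [set x | (1 / 2) ^+ k < `|f (s k.+1) x - f (s k) x|].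
pose F k := \bigcup_(n in [set n | (k <= n)%N]) E n.
have mE k : measurable (E k) by exact: measurable_dist_gt.
have mF k : measurable (F k) by exact: bigcup_measurable.
have Fcvg : mu (F k) @[k --> \oo] --> 0%E.
  by apply: deltaP => // k; apply: NP; rewrite /s /=; lia.
have [g gP] := mfun_limit (fun k => f (s k)).
have g_close k x : ~ F k x -> `|f (s k) x - g x| <= 2 * (1 / 2) ^+ k.
  move=> nFx.
  (* Outside [F k] every increment from index [k] on is dyadically small, so the subsequence
     converges at [x] and [g x] is its true limit. *)
  have [i ki|l fl flP] := @cvg_dyadic_increments _ (fun i => f (s i) x) k.
    by rewrite leNgt; apply/negP => Eix; apply: nFx; exists i.
  by rewrite (gP _ _ fl) flP.
exists g => e e0; apply/cvge0_ltP => [n|eta eta0].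
  exact/mu0/measurable_dist_gt.
have [r r0 rP] := pseudometric_generating_delta mu_pgp eta0.
have e20 : 0 < e / 2 by rewrite divr_gt0.
have [n0 n0P] := f_cauchy _ _ e20 r0.
(* One [k], independent of [n], serves all [n >= n0]. Smallness of [(1 / 2) ^+ k] below [e / 4]
   yields the middle bound. *)
have [k [n0k kE kF]] : exists k, [/\ (n0 <= k)%N, 2 * (1 / 2) ^+ k <= e / 2 &
    (mu (F k) < r%:E)%E].
  have F0 k : (0 <= mu (F k))%E by exact: mu0.
  have /(cvge0_ltP F0)/(_ r r0)[k1 _ k1P] := Fcvg.
  have [k2 _ k2P] := near_half_expr_lt (divr_gt0 e0 (ltr0Sn R 3)).
  exists (n0 + k1 + k2)%N; split; [lia| |by apply: k1P; rewrite /=; lia].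
  have /= := k2P (n0 + k1 + k2)%N (leq_addl _ _).
  by lra.
exists n0 => // n /= n0n.
apply: (@le_lt_trans _ _
  (mu ([set x | e / 2 < `|f n x - f (s k) x|] `|` F k))).
  apply: mu_mono; first exact: measurable_dist_gt.
    by apply: measurableU => //; exact: measurable_dist_gt.
  move=> x /(dist_gt_subU (f (s k)))[|/= egx]; first by left.
  (* A point at distance more than [e / 2] between [f (s k)] and [g] lies in [F k], as outside [F k]
     that distance is at most [2 * (1 / 2) ^+ k <= e / 2]. *)
  by right; apply: contrapT => /g_close; lra.
apply: rP => //; first exact: measurable_dist_gt.
by apply: n0P => //; rewrite /s; lia.
Qed.

End nonadditive.

Theorem theorem3p7 (d : measure_display) (T : measurableType d)
    (R : realType) (mu : set T -> \bar R)
    (mu_nonadd : nonadditive_measure mu)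
    (mu_C : property_C mu)
    (mu_pgp : pseudometric_generating mu)
    (f : nat -> {mfun T >-> R}) :
  cauchy_in_measure mu f <-> converges_in_measure mu f.
Proof.
split; first exact: cauchy_converges_in_measure.
exact: converges_in_measure_cauchy.
Qed.
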